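(* Let $A=(a_{rs})_{1\le r,s\le n}\in\mathbb{C}^{n\times n}$ be such that, for some $\kappa_o>0$, $\mathrm{Re}\,\big[\sum_{r,s}a_{rs}\xi_r\xi_s\big]\ge\kappa_o|\xi|^2$ for all $\xi\in\mathbb{R}^n$, and let $L=\mathrm{div}\,A\nabla$ be the associated scalar operator (the case $M=1$). Then $A_{\rm sym}\in\mathfrak{A}_L^{dis}$, i.e., $A_{\rm sym}:=\frac12(A+A^\top)$ is a distinguished coefficient tensor for $L$. In particular $\mathfrak{A}_L^{dis}\neq\emptyset$ whenever $M=1$.
   Context: $n\ge2$ is an integer. For $B=(b_{rs})\in\mathbb{C}^{n\times n}$ write $L_B:=\sum_{r,s}\partial_r(b_{rs}\partial_s\,\cdot)$; thus $L=L_A$, and $\mathfrak{A}_L$ is the set of all $B\in\mathbb{C}^{n\times n}$ with $L_B=L$. For $\xi\in\mathbb{R}^n\setminus\{0\}$ let $\mathrm{Symb}_L(\xi):=-\sum_{r,s}\xi_r\xi_sa_{rs}$ and $S(\xi):=[\mathrm{Symb}_L(\xi)]^{-1}$. A matrix $B=(b_{rs})\in\mathfrak{A}_L$ is called a distinguished coefficient tensor for $L$, written $B\in\mathfrak{A}_L^{dis}$, if for all $s,s'\in\{1,\dots,n\}$ (summing over the repeated index $r$) $$\big[b_{s's}-b_{ss'}+\xi_rb_{rs}\partial_{\xi_{s'}}-\xi_rb_{rs'}\partial_{\xi_s}\big]S(\xi)=0\qquad\forall\,\xi\in\mathbb{R}^n\setminus\{0\},$$ and, if $n=2$, also $$\int_{S^1}\big(b_{rs}\xi_{s'}-b_{rs'}\xi_s\big)\,\xi_rS(\xi)\,d\sigma_{S^1}(\xi)=0,$$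 where $\sigma_{S^1}$ is the arc-length measure on $S^1$. *)

(* Defs.v *)
From HB Require Import structures.
From mathcomp Require Import all_boot all_order all_algebra.
From mathcomp Require Import all_classical all_reals all_analysis.
From mathcomp.real_closed Require Export complex.

Set Implicit Arguments.
Unset Strict Implicit.
Unset Printing Implicit Defensive.

Import Order.TTheory GRing.Theory Num.Theory.
Import numFieldNormedType.Exports.

Local Open Scope classical_set_scope.
Local Open Scope ring_scope.
Local Open Scope complex_scope.

(* [R[i]] carries no normed [R]-module structure, so differentiation,
   continuity and integration of complex-valued functions of real variables
   are taken componentwise, on real and imaginary parts. *)

Definition cpartial (R : realType) (n : nat) (r : 'I_n)
    (f : 'rV[R]_n -> R[i]) (x : 'rV[R]_n) : R[i] :=
  'D_(delta_mx 0 r) (fun y => complex.Re (f y)) x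
  +i* 'D_(delta_mx 0 r) (fun y => complex.Im (f y)) x.

Definition cpartially_derivable (R : realType) (n : nat) (r : 'I_n)
    (f : 'rV[R]_n -> R[i]) : Prop :=
  forall x, derivable (fun y => complex.Re (f y)) x (delta_mx 0 r) /\
            derivable (fun y => complex.Im (f y)) x (delta_mx 0 r).

Definition ccontinuous (R : realType) (n : nat)
    (f : 'rV[R]_n -> R[i]) : Prop :=
  continuous (fun y => complex.Re (f y)) /\
  continuous (fun y => complex.Im (f y)).

(* [cCk k f]: f is of class C^k on R^n. *)
Fixpoint cCk (R : realType) (n k : nat) (f : 'rV[R]_n -> R[i]) : Prop :=
  ccontinuous f /\
  (if k is k'.+1 then
     forall r : 'I_n, cpartially_derivable r f /\ cCk k' (cpartial r f)
   else True).

Definition divform (R : realType) (n : nat) (B : 'M[R[i]]_n)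
    (u : 'rV[R]_n -> R[i]) (x : 'rV[R]_n) : R[i] :=
  \sum_(r < n) \sum_(s < n) cpartial r (fun y => B r s * cpartial s u y) x.

(* All coefficient matrices inducing the operator L = L_A.  Operators are
   compared on C^2 functions, where second-order derivatives are classical. *)
Definition coef_tensors (R : realType) (n : nat) (A : 'M[R[i]]_n) :
    set 'M[R[i]]_n :=
  [set B | forall u : 'rV[R]_n -> R[i], cCk 2 u ->
           forall x, divform B u x = divform A u x].

Definition symb (R : realType) (n : nat) (A : 'M[R[i]]_n)
    (xi : 'rV[R]_n) : R[i] :=
  - \sum_(r < n) \sum_(s < n) (xi 0 r)%:C * (xi 0 s)%:C * A r s.

Definition symb_inv (R : realType) (n : nat) (A : 'M[R[i]]_n)
    (xi : 'rV[R]_n) : R[i] := (symb A xi)^-1.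

(* (cos t, sin t) when n = 2; only used there. *)
Definition circle_pt (R : realType) (n : nat) (t : R) : 'rV[R]_n :=
  \row_(i < n) (if (i : nat) == 0%N then cos t else sin t).

(* Integral over S^1 against arc length, via the unit-speed parametrization
   t |-> (cos t, sin t), 0 <= t <= 2 pi. *)
Definition circle_integral (R : realType) (n : nat)
    (f : 'rV[R]_n -> R[i]) : R[i] :=
  Rintegral (@lebesgue_measure R) `[0, 2 * pi]
    (fun t => complex.Re (f (circle_pt n t)))
  +i* Rintegral (@lebesgue_measure R) `[0, 2 * pi]
    (fun t => complex.Im (f (circle_pt n t))).

(* Distinguished coefficient tensors for L = L_A; the repeated index r is
   summed only in the terms in which it occurs. *)
Definition distinguished (R : realType) (n : nat) (A : 'M[R[i]]_n) :
    set 'M[R[i]]_n :=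
  [set B | [/\ coef_tensors A B,
    forall (s s' : 'I_n) (xi : 'rV[R]_n), xi != 0 ->
      (B s' s - B s s') * symb_inv A xi
      + \sum_(r < n) ((xi 0 r)%:C * B r s * cpartial s' (symb_inv A) xi
                      - (xi 0 r)%:C * B r s' * cpartial s (symb_inv A) xi) = 0
    & n = 2%N -> forall s s' : 'I_n,
      circle_integral (fun xi : 'rV[R]_n =>
        \sum_(r < n) (B r s * (xi 0 s')%:C - B r s' * (xi 0 s)%:C)
                     * (xi 0 r)%:C * symb_inv A xi) = 0]].

(* Main.v *)
Require Import Defs.
From HB Require Import structures.
From mathcomp Require Import all_boot all_order all_algebra.
From mathcomp Require Import all_classical all_reals all_analysis.
From mathcomp.real_closed Require Import complex.
From mathcomp Require Import ring.

Set Implicit Arguments.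
Unset Strict Implicit.
Unset Printing Implicit Defensive.

Import Order.TTheory GRing.Theory Num.Theory.
Import numFieldNormedType.Exports.

Local Open Scope classical_set_scope.
Local Open Scope ring_scope.
Local Open Scope complex_scope.

(** Write B for the symmetric part of A, Q(xi) = sum_rs xi_r xi_s b_rs, so that
the symbol is -Q, and N_s(xi) = sum_r xi_r b_rs for its conormal components.

- B induces the same operator as A: on C^2 functions the operator is
  sum_rs b_rs d_r d_s u, and mixed partials commute ([cpartial_comm], from the
  mean value argument of [mixed_derive_comm]), so that only the symmetric part
  of the coefficients is seen ([sum_symmetrize]).

- Since B is symmetric, d_s Q = 2 N_s, hence d_s S = 2 N_s / Q^2
  ([cpartial_symb_inv]).  The zeroth-order part of the pointwise condition
  vanishes because b_ss' = b_s's, and the first-order part is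
  N_s d_s' S - N_s' d_s S, where both terms equal 2 N_s N_s' / Q^2.

- For n = 2 and s <> s', the function N_s xi_s' - N_s' xi_s on the circle is, up
  to sign, the scalar product of N with the velocity of t |-> (cos t, sin t)
  ([conormal_rotation]), that is half the derivative of Q along the circle.  The
  integrand is therefore a constant multiple of the logarithmic derivative of
  Q.  By ellipticity Re Q > 0, so Q stays in a half plane on which the logarithm
  is single-valued ([is_cderive_log]), and the integral over the closed circle
  vanishes ([circle_integral_exact]). *)

(** * Equality of mixed derivatives *)

(** The difference quotients on both sides are the same functions. *)
Lemma is_derive_line (R : realType) (V : normedModType R) (f : V -> R)
    (x v : V) (t d : R) :
  is_derive (t *: v + x) v f d ->
  is_derive t 1 (fun a : R => f (a *: v + x)) d.
Proof.
have E : (fun h : R => h^-1 *: (((fun a : R => f (a *: v + x)) \o shift t) (h *: 1)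
             - f (t *: v + x))) =
         (fun h : R => h^-1 *: ((f \o shift (t *: v + x)) (h *: v) - f (t *: v + x))).
  by apply/funext => h /=; rewrite scalerDl addrA [h%:A]mulr1.
by move=> [df <-]; apply: DeriveDef; rewrite /derivable /derive E.
Qed.

(** The mean value theorem is used twice: along [v] for the increment of [f] in
direction [w], then along [w] for the resulting increment of [fv]. *)
Lemma second_difference (R : realType) (V : normedModType R)
    (f fv fvw : V -> R) (v w x : V) (h : R) : 0 < h ->
  (forall y, is_derive y v f (fv y)) -> (forall y, is_derive y w fv (fvw y)) ->
  exists t s : R, [/\ 0 < t < h, 0 < s < h &
    f (h *: v + (h *: w + x)) - f (h *: v + x) - (f (h *: w + x) - f x) =
    fvw (s *: w + (t *: v + x)) * h * h].
Proof.
move=> h0 dv dw.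
pose g (a : R) := f (a *: v + (h *: w + x)) - f (a *: v + x).
pose dg (a : R) := fv (a *: v + (h *: w + x)) - fv (a *: v + x).
have gd (a : R) : is_derive a 1 g (dg a).
  have d1 := is_derive_line (dv (a *: v + (h *: w + x))).
  have d2 := is_derive_line (dv (a *: v + x)).
  exact: (is_deriveB d1 d2).
have [|t] := MVT h0 (fun a _ => gd a).
  by apply: derivable_within_continuous => a _; exact: (@ex_derive _ _ _ _ _ _ _ (gd a)).
rewrite in_itv /= => t0h; rewrite /g scale0r !add0r subr0 => ->.
pose k (b : R) := fv (b *: w + (t *: v + x)).
have kd (b : R) : is_derive b 1 k (fvw (b *: w + (t *: v + x))).
  exact: is_derive_line.
have [|s] := MVT h0 (fun b _ => kd b).
  by apply: derivable_within_continuous => b _; exact: (@ex_derive _ _ _ _ _ _ _ (kd b)).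
rewrite in_itv /= => s0h; rewrite /k scale0r add0r subr0 => e.
by exists t, s; split => //; rewrite /dg addrCA e.
Qed.

(** The second difference of [f] is symmetric in [v] and [w], so on every scale
[fvw] and [fwv] take a common value near [x]; continuity at [x] concludes.
Derivatives are passed as named functions so that the proof only ever compares
their values, not the limits that define them. *)
Lemma mixed_derive_comm (R : realType) (V : normedModType R)
    (f fv fw fvw fwv : V -> R) (v w x : V) :
  (forall y, is_derive y v f (fv y)) -> (forall y, is_derive y w f (fw y)) ->
  (forall y, is_derive y w fv (fvw y)) -> (forall y, is_derive y v fw (fwv y)) ->
  {for x, continuous fvw} -> {for x, continuous fwv} ->
  fvw x = fwv x.
Proof.
move=> dv dw dvw dwv cvw cwv.
apply/eqP; rewrite -subr_eq0 -normr_le0.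
apply/ler_addgt0Pr => e e0; rewrite add0r.
have e20 : 0 < e / 2 by rewrite divr_gt0.
have /cvgrPdist_lt/(_ _ e20)/nbhs_ballP[d1 /= d10 H1] := cvw.
have /cvgrPdist_lt/(_ _ e20)/nbhs_ballP[d2 /= d20 H2] := cwv.
pose N := `|v| + `|w| + 1.
have N0 : 0 < N by rewrite /N ltr_wpDl.
pose h := Num.min d1 d2 / N.
have h0 : 0 < h by rewrite divr_gt0 // lt_min d10.
(* [h] is chosen so that the parallelogram with sides [h *: v] and [h *: w] at [x]
   lies in both continuity balls. *)
have near_x (a b : R) : 0 < a < h -> 0 < b < h ->
    `|x - (b *: w + (a *: v + x))| < Num.min d1 d2.
  move=> /andP[a0 ah] /andP[b0 bh].
  rewrite addrA opprD addrCA subrr addr0 normrN.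
  have : `|b *: w + a *: v| <= b * `|w| + a * `|v|.
    by rewrite (le_trans (ler_normD _ _))// !normrZ !gtr0_norm.
  move/le_lt_trans; apply.
  have -> : Num.min d1 d2 = h * N by rewrite /h divfK // gt_eqF.
  have vw : b * `|w| + a * `|v| <= h * `|w| + h * `|v|.
    by rewrite lerD // ler_wpM2r // ltW.
  by rewrite (le_lt_trans vw) // /N !mulrDr mulr1 [X in X < _]addrC ltrDl.
have [t [s [t0h s0h E1]]] := second_difference x h0 dv dvw.
have [t' [s' [t'0h s'0h E2]]] := second_difference x h0 dw dwv.
have P1 : `|fvw x - fvw (s *: w + (t *: v + x))| < e / 2.
  apply: H1; rewrite -ball_normE /=.
  by have := near_x _ _ t0h s0h; rewrite lt_min => /andP[].
have P2 : `|fwv x - fwv (s' *: v + (t' *: w + x))| < e / 2.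
  apply: H2; rewrite -ball_normE /= [s' *: v + _]addrCA.
  by have := near_x _ _ s'0h t'0h; rewrite lt_min => /andP[].
have E : fvw (s *: w + (t *: v + x)) = fwv (s' *: v + (t' *: w + x)).
  have hn0 : h != 0 by rewrite gt_eqF.
  do 2!apply: (mulIf hn0).
  have swap : h *: w + (h *: v + x) = h *: v + (h *: w + x) by rewrite addrCA.
  have alg (p a b c : R) : p - a - (b - c) = p - b - (a - c) by ring.
  by rewrite -E1 -E2 swap; exact: alg.
rewrite -E in P2.
rewrite [e]splitr (le_trans (ler_distD (fvw (s *: w + (t *: v + x))) _ _)) //.
by apply: lerD; [exact: ltW|rewrite distrC; exact: ltW].
Qed.

(** * Componentwise differentiation of complex-valued functions *)

Lemma is_deriveV (R : realType) (V : normedModType R) (f : V -> R) (x v : V)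
    (d : R) : f x != 0 -> is_derive x v f d ->
  is_derive x v (fun y => (f y)^-1) (- f x ^- 2 * d).
Proof.
by move=> fx0 [df <-]; split; [exact: derivableV|rewrite deriveV].
Qed.

(** Directional derivative in the componentwise sense, bundling existence and value,
so that the rules of calculus can be stated with complex arithmetic. *)
Definition is_cderive (R : realType) (V : normedModType R) (x v : V)
    (f : V -> R[i]) (d : R[i]) : Prop :=
  is_derive x v (fun y => complex.Re (f y)) (complex.Re d) /\
  is_derive x v (fun y => complex.Im (f y)) (complex.Im d).

Section ComplexDerivative.
Variables (R : realType) (V : normedModType R).
Implicit Types (x v : V) (f g : V -> R[i]) (c d e : R[i]).

Let ReD c d : complex.Re (c + d) = complex.Re c + complex.Re d.
Proof. by case: c d => [? ?] []. Qed.

Let ImD c d : complex.Im (c + d) = complex.Im c + complex.Im d.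
Proof. by case: c d => [? ?] []. Qed.

Let ReM c d : complex.Re (c * d) =
  complex.Re c * complex.Re d - complex.Im c * complex.Im d.
Proof. by case: c d => [? ?] []. Qed.

Let ImM c d : complex.Im (c * d) =
  complex.Re c * complex.Im d + complex.Im c * complex.Re d.
Proof. by case: c d => [? ?] []. Qed.

Lemma is_cderive_cst c x v : is_cderive x v (fun=> c) 0.
Proof. by split; apply: is_derive_cst. Qed.

Lemma is_cderiveD f g x v d e : is_cderive x v f d -> is_cderive x v g e ->
  is_cderive x v (fun y => f y + g y) (d + e).
Proof.
move=> [fR fI] [gR gI]; split.
  by under eq_fun do rewrite ReD; rewrite ReD; exact: (is_deriveD fR gR).
by under eq_fun do rewrite ImD; rewrite ImD; exact: (is_deriveD fI gI).
Qed.

Lemma is_cderiveM f g x v d e : is_cderive x v f d -> is_cderive x v g e ->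
  is_cderive x v (fun y => f y * g y) (f x * e + g x * d).
Proof.
move=> [fR fI] [gR gI]; split.
  under eq_fun do rewrite ReM.
  apply: is_derive_eq (is_deriveB (is_deriveM fR gR) (is_deriveM fI gI)) _.
  by rewrite ReD !ReM /GRing.scale /=; ring.
under eq_fun do rewrite ImM.
apply: is_derive_eq (is_deriveD (is_deriveM fR gI) (is_deriveM fI gR)) _.
by rewrite ImD !ImM /GRing.scale /=; ring.
Qed.

Lemma is_cderiveZ c f x v d : is_cderive x v f d ->
  is_cderive x v (fun y => c * f y) (c * d).
Proof.
move=> df; have := is_cderiveM (is_cderive_cst c x v) df.
by rewrite mulr0 addr0.
Qed.

Lemma is_cderiveN f x v d : is_cderive x v f d ->
  is_cderive x v (fun y => - f y) (- d).
Proof.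
move=> /(is_cderiveZ (-1)); rewrite mulN1r.
by under eq_fun do rewrite mulN1r.
Qed.

Lemma is_cderive_sum (n : nat) (h : 'I_n -> V -> R[i]) x v
    (dh : 'I_n -> R[i]) : (forall i, is_cderive x v (h i) (dh i)) ->
  is_cderive x v (fun y => \sum_(i < n) h i y) (\sum_(i < n) dh i).
Proof.
move=> dhi; elim: n h dh dhi => [|n ih] h dh dhi.
  by under eq_fun do rewrite big_ord0; rewrite big_ord0; exact: is_cderive_cst.
under eq_fun do rewrite big_ord_recr /=.
rewrite big_ord_recr /=; apply: is_cderiveD => //.
exact: (ih (fun i => h (widen_ord (leqnSn n) i))).
Qed.

Lemma is_cderive_real (f : V -> R) x v (d : R) :
  is_derive x v f d -> is_cderive x v (fun y => (f y)%:C) d%:C.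
Proof. by move=> df; split => //=; exact: is_derive_cst. Qed.

Let sqrc c : c ^+ 2 = (complex.Re c ^+ 2 - complex.Im c ^+ 2)
    +i* (2 * complex.Re c * complex.Im c).
Proof.
have imE (a b : R) : a * b + b * a = 2 * a * b by ring.
by case: c => a b; rewrite expr2; apply/eqP; rewrite eq_complex /= -!expr2 imE !eqxx.
Qed.

Let ReV c : complex.Re c^-1 =
  complex.Re c / (complex.Re c ^+ 2 + complex.Im c ^+ 2).
Proof. by case: c. Qed.

Let ImV c : complex.Im c^-1 =
  - complex.Im c / (complex.Re c ^+ 2 + complex.Im c ^+ 2).
Proof. by case: c => a b /=; rewrite mulNr. Qed.

Let sqr_norm_neq0 c : c != 0 -> complex.Re c ^+ 2 + complex.Im c ^+ 2 != 0.
Proof.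
apply: contra; rewrite paddr_eq0 ?sqr_ge0 // !sqrf_eq0 => /andP[r0 i0].
by rewrite eq_complex r0 i0.
Qed.

Let sqr_norm_sqr (a b : R) :
  (a ^+ 2 - b ^+ 2) ^+ 2 + (2 * a * b) ^+ 2 = (a ^+ 2 + b ^+ 2) ^+ 2.
Proof. by ring. Qed.

Let Re_inv_derive d c : complex.Re (- d / c ^+ 2) =
  (- complex.Re d * (complex.Re c ^+ 2 - complex.Im c ^+ 2)
     - complex.Im d * (2 * complex.Re c * complex.Im c)) /
  (complex.Re c ^+ 2 + complex.Im c ^+ 2) ^+ 2.
Proof.
have alg (p q a b m : R) :
  - p * (a / m) - - q * (- b / m) = (- p * a - q * b) / m by ring.
by rewrite ReM ReV ImV sqrc /= sqr_norm_sqr; case: d => p q; exact: alg.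
Qed.

Let Im_inv_derive d c : complex.Im (- d / c ^+ 2) =
  (complex.Re d * (2 * complex.Re c * complex.Im c)
     - complex.Im d * (complex.Re c ^+ 2 - complex.Im c ^+ 2)) /
  (complex.Re c ^+ 2 + complex.Im c ^+ 2) ^+ 2.
Proof.
have alg (p q a b m : R) :
  - p * (- b / m) + - q * (a / m) = (p * b - q * a) / m by ring.
by rewrite ImM ReV ImV sqrc /= sqr_norm_sqr; case: d => p q; exact: alg.
Qed.

Lemma is_cderiveV f x v d : f x != 0 -> is_cderive x v f d ->
  is_cderive x v (fun y => (f y)^-1) (- d / f x ^+ 2).
Proof.
move=> fx0 [fR fI].
pose N y := complex.Re (f y) ^+ 2 + complex.Im (f y) ^+ 2.
have Nx0 : N x != 0 by exact: sqr_norm_neq0.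
have dN := is_deriveD (is_deriveX 2 fR) (is_deriveX 2 fI).
have dNV := is_deriveV Nx0 dN.
split.
  under eq_fun do rewrite ReV.
  apply: is_derive_eq (is_deriveM fR dNV) _.
  have alg (a b p q : R) : a ^+ 2 + b ^+ 2 != 0 ->
      a * (- (a ^+ 2 + b ^+ 2) ^- 2 * (2 * a * p + 2 * b * q)) +
      (a ^+ 2 + b ^+ 2)^-1 * p =
      (- p * (a ^+ 2 - b ^+ 2) - q * (2 * a * b)) / (a ^+ 2 + b ^+ 2) ^+ 2.
    by move=> ab0; field.
  by rewrite Re_inv_derive; exact: alg.
under eq_fun do rewrite ImV.
apply: is_derive_eq (is_deriveM (is_deriveN fI) dNV) _.
have alg (a b p q : R) : a ^+ 2 + b ^+ 2 != 0 ->
    - b * (- (a ^+ 2 + b ^+ 2) ^- 2 * (2 * a * p + 2 * b * q)) +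
    (a ^+ 2 + b ^+ 2)^-1 * - q =
    (p * (2 * a * b) - q * (a ^+ 2 - b ^+ 2)) / (a ^+ 2 + b ^+ 2) ^+ 2.
  by move=> ab0; field.
by rewrite Im_inv_derive; exact: alg.
Qed.

End ComplexDerivative.

(** [ln `|g|^2 / 2 + i atan (Im g / Re g)] is a branch of the logarithm of [g], up to
a constant, wherever [Re g] does not vanish. *)
Lemma is_cderive_log (R : realType) (g : R -> R[i]) (t : R) (d : R[i]) :
  complex.Re (g t) != 0 -> is_cderive t 1 g d ->
  is_cderive t 1 (fun a => (2^-1 * ln (complex.Re (g a) ^+ 2 + complex.Im (g a) ^+ 2))
                        +i* atan (complex.Im (g a) / complex.Re (g a)))
    (d / g t).
Proof.
move=> g0 [gR gI].
pose N a := complex.Re (g a) ^+ 2 + complex.Im (g a) ^+ 2.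
have Nt0 : 0 < N t by rewrite /N ltr_pwDl ?sqr_ge0 // exprn_even_gt0.
have dN := is_deriveD (is_deriveX 2 gR) (is_deriveX 2 gI).
have dln : is_derive (N t) 1 (@ln R) (N t)^-1 by exact: is_derive1_ln.
have dL := is_deriveZ 2^-1 (is_derive1_comp dln dN).
pose q a := complex.Im (g a) / complex.Re (g a).
have dq : is_derive t 1 q _ := is_deriveM gI (is_deriveV g0 gR).
have dA := is_derive1_comp (is_derive1_atan (q t)) dq.
split.
  apply: (is_derive_eq dL).
  case: d gR gI dN dL dq dA => p r _ _ _ _ _ _.
  have alg (a b : R) : a ^+ 2 + b ^+ 2 != 0 ->
      2^-1 * ((a ^+ 2 + b ^+ 2)^-1 * (2 * a * p + 2 * b * r)) =
      p * (a / (a ^+ 2 + b ^+ 2)) - r * - (b / (a ^+ 2 + b ^+ 2)).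
    by move=> ab0; field.
  by move: (lt0r_neq0 Nt0); rewrite /N; case: (g t) => a b /=; exact: alg.
apply: (is_derive_eq dA).
case: d gR gI dN dL dq dA => p r _ _ _ _ _ _.
have alg (a b : R) : a != 0 -> a ^+ 2 + b ^+ 2 != 0 ->
    (1 + (b / a) ^+ 2)^-1 * (b * (- a ^- 2 * p) + a^-1 * r) =
    p * - (b / (a ^+ 2 + b ^+ 2)) + r * (a / (a ^+ 2 + b ^+ 2)).
  move=> a0 ab0; have -> : 1 + (b / a) ^+ 2 = (a ^+ 2 + b ^+ 2) / a ^+ 2 by field.
  by field; rewrite a0 ab0.
by move: (lt0r_neq0 Nt0); rewrite /N /q; case: (g t) g0 => a b /=; exact: alg.
Qed.

(** * Integration of exact derivatives over the circle *)

(** The fundamental theorem of calculus on a closed curve.  Differentiability of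
the integrand along the circle serves as a source of its continuity. *)
Lemma circle_integral_exact (R : realType) (n : nat) (f : 'rV[R]_n -> R[i])
    (F : R -> R[i]) :
  (forall t : R, exists d, is_cderive t 1 (fun t => f (circle_pt n t)) d) ->
  (forall t : R, is_cderive t 1 F (f (circle_pt n t))) ->
  F (2 * pi) = F 0 ->
  circle_integral f = 0.
Proof.
move=> df dF Fper.
have pi20 : 0 < 2 * pi :> R by rewrite mulr_gt0 // pi_gt0.
have real_case (g G : R -> R) : (forall t : R, exists d, is_derive t 1 g d) ->
    (forall t : R, is_derive t 1 G (g t)) -> G (2 * pi) = G 0 ->
    Rintegral (@lebesgue_measure R) `[0, 2 * pi] g = 0.
  move=> dg dG Gper.
  have cG : continuous G.
    move=> t; apply/differentiable_continuous/derivable1_diffP.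
    exact: (@ex_derive _ _ _ _ _ _ _ (dG t)).
  rewrite /Rintegral (continuous_FTC2 pi20 (F := G)).
  - by rewrite Gper -EFinB subrr.
  - apply: derivable_within_continuous => t _; have [d dgt] := dg t.
    exact: (@ex_derive _ _ _ _ _ _ _ dgt).
  - split; last 2 first.
    + by apply: cvg_at_right_filter; exact: cG.
    + by apply: cvg_at_left_filter; exact: cG.
    + by move=> t _; exact: (@ex_derive _ _ _ _ _ _ _ (dG t)).
  - by move=> t _; rewrite derive1E; exact: (@derive_val _ _ _ _ _ _ _ (dG t)).
apply/eqP; rewrite eq_complex /=; apply/andP; split; apply/eqP.
  apply: (real_case _ (fun t => complex.Re (F t))); last by rewrite Fper.
    by move=> t; have [d [dR _]] := df t; exists (complex.Re d).
  by move=> t; have [] := dF t.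
apply: (real_case _ (fun t => complex.Im (F t))); last by rewrite Fper.
  by move=> t; have [d [_ dI]] := df t; exists (complex.Im d).
by move=> t; have [] := dF t.
Qed.

(** * The symbol and its derivatives *)

(** The components of the conormal field of [B]: half the gradient of the quadratic
form when [B] is symmetric. *)
Definition conormal (R : realType) (n : nat) (B : 'M[R[i]]_n) (xi : 'rV[R]_n)
  (s : 'I_n) : R[i] := \sum_(r < n) (xi 0 r)%:C * B r s.

(** The chain rule for the quadratic form along a path [xi] whose coordinates have
derivatives [dxi].  It is used with the identity path, for partial derivatives
in [xi], and with the parametrization of the circle. *)
Lemma is_cderive_symb (R : realType) (V : normedModType R) (n : nat)
    (B : 'M[R[i]]_n) (xi : V -> 'rV[R]_n) (x v : V) (dxi : 'I_n -> R) :
  (forall r s, B r s = B s r) ->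
  (forall i, is_derive x v (fun y => xi y 0 i) (dxi i)) ->
  is_cderive x v (fun y => symb B (xi y))
    (- (2 * \sum_(s < n) (dxi s)%:C * conormal B (xi x) s)).
Proof.
move=> symB dx; apply: is_cderiveN.
have dc i := is_cderive_real (dx i).
have := is_cderive_sum (fun r => is_cderive_sum (fun s =>
  is_cderiveM (is_cderiveM (dc r) (dc s)) (is_cderive_cst (B r s) x v))).
rewrite (_ : \sum_(_ < n) _ = 2 * \sum_(s < n) (dxi s)%:C * conormal B (xi x) s) //.
pose E r s := (dxi s)%:C * ((xi x 0 r)%:C * B r s).
transitivity (\sum_(r < n) \sum_(s < n) (E r s + E s r)).
  apply: eq_bigr => r _; apply: eq_bigr => s _.
  by rewrite /E (symB s r); ring.
under eq_bigr do rewrite big_split /=.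
rewrite big_split /= [X in _ + X]exchange_big /= -mulr2n mulr_natl; congr (_ *+ 2).
by rewrite exchange_big; apply: eq_bigr => s _; rewrite /conormal mulr_sumr.
Qed.

(** A symmetric [P] pairs to zero with the antisymmetric part of [A]. *)
Lemma sum_symmetrize (R : realType) (n : nat) (A : 'M[R[i]]_n)
    (P : 'I_n -> 'I_n -> R[i]) : (forall r s, P r s = P s r) ->
  \sum_(r < n) \sum_(s < n) (2^-1 *: (A + A^T)) r s * P r s =
  \sum_(r < n) \sum_(s < n) A r s * P r s.
Proof.
move=> symP; set S := RHS.
have -> : S = 2^-1 * (S + S).
  by rewrite -mulr2n -[S *+ 2]mulr_natl mulKf // pnatr_eq0.
rewrite /S [X in _ = _ * (_ + X)]exchange_big /= -big_split mulr_sumr.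
apply: eq_bigr => r _; rewrite -big_split mulr_sumr; apply: eq_bigr => s _.
by rewrite !mxE (symP s r) /= -mulrDl mulrA.
Qed.

Lemma symb_symmetrize (R : realType) (n : nat) (A : 'M[R[i]]_n) :
  symb A = symb (2^-1 *: (A + A^T)).
Proof.
apply/funext => xi; rewrite /symb; congr (- _).
transitivity (\sum_(r < n) \sum_(s < n) A r s * ((xi 0 r)%:C * (xi 0 s)%:C)).
  by do 2!(apply: eq_bigr => ? _); rewrite mulrC.
rewrite -sum_symmetrize; last by move=> r s; rewrite mulrC.
by do 2!(apply: eq_bigr => ? _); rewrite mulrC.
Qed.

(** * The symmetric part induces the same operator *)

Lemma is_cderive_cpartial (R : realType) (n : nat) (f : 'rV[R]_n -> R[i])
    (r : 'I_n) (x : 'rV[R]_n) :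
  cpartially_derivable r f -> is_cderive x (delta_mx 0 r) f (cpartial r f x).
Proof.
move=> df; rewrite /cpartial; have [] := df x.
by move=> /derivableP dR /derivableP dI; split.
Qed.

Lemma mixed_cderive_comm (R : realType) (V : normedModType R)
    (f fv fw fvw fwv : V -> R[i]) (v w x : V) :
  (forall y, is_cderive y v f (fv y)) -> (forall y, is_cderive y w f (fw y)) ->
  (forall y, is_cderive y w fv (fvw y)) ->
  (forall y, is_cderive y v fw (fwv y)) ->
  continuous (fun y => complex.Re (fvw y)) ->
  continuous (fun y => complex.Im (fvw y)) ->
  continuous (fun y => complex.Re (fwv y)) ->
  continuous (fun y => complex.Im (fwv y)) ->
  fvw x = fwv x.
Proof.
move=> dv dw dvw dwv cR cI cR' cI'.
apply/eqP; rewrite eq_complex; apply/andP; split; apply/eqP.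
  exact: (mixed_derive_comm (fun y => (dv y).1) (fun y => (dw y).1)
    (fun y => (dvw y).1) (fun y => (dwv y).1) (cR x) (cR' x)).
exact: (mixed_derive_comm (fun y => (dv y).2) (fun y => (dw y).2)
  (fun y => (dvw y).2) (fun y => (dwv y).2) (cI x) (cI' x)).
Qed.

Lemma cpartial_comm (R : realType) (n : nat) (u : 'rV[R]_n -> R[i])
    (r s : 'I_n) (x : 'rV[R]_n) : cCk 2 u ->
  cpartial r (cpartial s u) x = cpartial s (cpartial r u) x.
Proof.
move=> [_ /= C2].
have [ur [_ /(_ s) [urs [[cR cI] _]]]] := C2 r.
have [us [_ /(_ r) [usr [[cR' cI'] _]]]] := C2 s.
exact: (mixed_cderive_comm x (fun y => is_cderive_cpartial y us)
  (fun y => is_cderive_cpartial y ur) (fun y => is_cderive_cpartial y usr)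
  (fun y => is_cderive_cpartial y urs) cR' cI' cR cI).
Qed.

Lemma cpartialE (R : realType) (n : nat) (f : 'rV[R]_n -> R[i]) (r : 'I_n)
    (x : 'rV[R]_n) (d : R[i]) :
  is_cderive x (delta_mx 0 r) f d -> cpartial r f x = d.
Proof.
case: d => a b [fR fI]; rewrite /cpartial.
by rewrite (@derive_val _ _ _ _ _ _ _ fR) (@derive_val _ _ _ _ _ _ _ fI).
Qed.

Lemma divform_C2 (R : realType) (n : nat) (B : 'M[R[i]]_n)
    (u : 'rV[R]_n -> R[i]) (x : 'rV[R]_n) : cCk 2 u ->
  divform B u x = \sum_(r < n) \sum_(s < n) B r s * cpartial r (cpartial s u) x.
Proof.
move=> [_ /= C2]; apply: eq_bigr => r _; apply: eq_bigr => s _.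
have [_ [_ /(_ r) [usr _]]] := C2 s.
apply: cpartialE; apply: is_cderiveZ.
exact: is_cderive_cpartial.
Qed.

Lemma coef_tensors_symmetrize (R : realType) (n : nat) (A : 'M[R[i]]_n) :
  coef_tensors A (2^-1 *: (A + A^T)).
Proof.
move=> u uC2 x; rewrite !divform_C2 //.
by apply: sum_symmetrize => r s; exact: cpartial_comm.
Qed.

(** * The pointwise condition *)

Lemma is_derive_coord (R : realType) (n : nat) (x v : 'rV[R]_n) (i : 'I_n) :
  is_derive x v (fun y : 'rV[R]_n => y 0 i) (v 0 i).
Proof.
have dx : derivable (@id 'rV[R]_n) x v by exact: derivable_id.
have /derivable_mxP dxi := dx.
split; first exact: dxi.
by have := derive_mx dx; rewrite derive_id => /rowP/(_ i) /[!mxE] ->.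
Qed.

Lemma cpartial_symb_inv (R : realType) (n : nat) (B : 'M[R[i]]_n)
    (xi : 'rV[R]_n) (s : 'I_n) :
  (forall r s, B r s = B s r) -> symb B xi != 0 ->
  cpartial s (symb_inv B) xi = 2 * conormal B xi s / symb B xi ^+ 2.
Proof.
move=> symB nz; apply: cpartialE.
have := is_cderiveV nz (is_cderive_symb symB (is_derive_coord xi (delta_mx 0 s))).
rewrite opprK (bigD1 s) //= big1 => [|j js]; last first.
  by rewrite mxE eqxx (negPf js) mul0r.
by rewrite mxE !eqxx mul1r addr0.
Qed.

Lemma symb_elliptic (R : realType) (n : nat) (A : 'M[R[i]]_n) (kappa : R)
    (xi : 'rV[R]_n) : 0 < kappa ->
  kappa * (\sum_(i < n) xi 0 i ^+ 2) <=
    complex.Re (\sum_(r < n) \sum_(s < n) A r s * (xi 0 r)%:C * (xi 0 s)%:C) ->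
  xi != 0 -> complex.Re (symb A xi) < 0.
Proof.
move=> k0 ell xi0.
have -> : symb A xi = - \sum_(r < n) \sum_(s < n) A r s * (xi 0 r)%:C * (xi 0 s)%:C.
  congr (- _); do 2!(apply: eq_bigr => ? _).
  by rewrite -[RHS]mulrA [RHS]mulrC.
move: ell; case: (\sum_(r < n) _) => a b /= ell.
rewrite oppr_lt0 (lt_le_trans _ ell) // mulr_gt0 //.
have sq_ge0 i : true -> 0 <= xi 0 i ^+ 2 by rewrite sqr_ge0.
rewrite lt_neqAle sumr_ge0 // andbT.
apply: contra xi0; rewrite eq_sym psumr_eq0 // => /allP z.
apply/eqP/rowP => i; rewrite mxE.
by apply/eqP; rewrite -sqrf_eq0; exact: (z i (mem_index_enum _)).
Qed.

(** * The circle condition *)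

Definition circle_velocity (R : realType) (n : nat) (t : R) (i : 'I_n) : R :=
  if (i : nat) == 0%N then - sin t else cos t.

Lemma is_derive_circle (R : realType) (n : nat) (i : 'I_n) (t : R) :
  is_derive t 1 (fun a => circle_pt n a 0 i) (circle_velocity t i).
Proof.
rewrite /circle_velocity; under eq_fun do rewrite mxE.
by case: ifP => _; [exact: is_derive_cos|exact: is_derive_sin].
Qed.

Lemma is_derive_circle_velocity (R : realType) (n : nat) (i : 'I_n) (t : R) :
  is_derive t 1 (fun a => circle_velocity a i) (- circle_pt n t 0 i).
Proof.
rewrite mxE /circle_velocity; case: ifP => _; last exact: is_derive_cos.
exact: (is_deriveN (is_derive_sin t)).
Qed.

Lemma circle_pt_neq0 (R : realType) (t : R) : circle_pt 2 t != 0.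
Proof.
apply/eqP => /rowP z; have := z 0; have := z 1; rewrite !mxE /= => s0 c0.
by have := cos2Dsin2 t; rewrite s0 c0 expr0n addr0 => /esym/eqP; rewrite oner_eq0.
Qed.

(** In dimension two the antisymmetric expression on the left has a single
independent entry, and [s - s'] records its sign. *)
Lemma conormal_rotation (R : realType) (B : 'M[R[i]]_2) (t : R) (s s' : 'I_2) :
  \sum_(r < 2) (B r s * (circle_pt 2 t 0 s')%:C - B r s' * (circle_pt 2 t 0 s)%:C)
               * (circle_pt 2 t 0 r)%:C =
  (s%:R - s'%:R) *
  \sum_(j < 2) (circle_velocity t j)%:C * conormal B (circle_pt 2 t) j.
Proof.
have ord2 (j : 'I_2) : j = ord0 \/ j = lift ord0 ord0.
  by case: j => [[|[|//]] ?]; [left|right]; exact: val_inj.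
rewrite /conormal /circle_velocity !big_ord_recl !big_ord0 /= !mxE /=.
rewrite (rmorphN (real_complex R)) /=.
by case: (ord2 s) => ->; case: (ord2 s') => ->; rewrite /= /bump /=; ring.
Qed.

(** The integrand is [c] times the logarithmic derivative of the symbol along the
circle. *)
Lemma circle_condition (R : realType) (B : 'M[R[i]]_2) (s s' : 'I_2) :
  (forall r s, B r s = B s r) ->
  (forall xi : 'rV[R]_2, xi != 0 -> complex.Re (symb B xi) < 0) ->
  circle_integral (fun xi : 'rV[R]_2 =>
    \sum_(r < 2) (B r s * (xi 0 s')%:C - B r s' * (xi 0 s)%:C)
                 * (xi 0 r)%:C * symb_inv B xi) = 0.
Proof.
move=> symB neg.
(* The factor [1/2] compensates the [2] in the derivative of the quadratic form; the
   order of [s] and [s'] accounts for the minus sign in the symbol. *)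
pose c : R[i] := (s'%:R - s%:R) / 2.
pose g t := symb B (circle_pt 2 t).
pose dg t := - (2 * \sum_(j < 2)
  (circle_velocity t j)%:C * conormal B (circle_pt 2 t) j).
have Reg t : complex.Re (g t) != 0 by rewrite ltr0_neq0 // neg // circle_pt_neq0.
have gn0 t : g t != 0.
  by apply: contra (Reg t) => /eqP ->.
have gd (t : R) : is_cderive t 1 g (dg t).
  exact: (is_cderive_symb symB (fun i => is_derive_circle i t)).
set f := fun xi => _.
have E t : f (circle_pt 2 t) = c * (dg t / g t).
  rewrite /f -mulr_suml conormal_rotation /c /dg /symb_inv -/(g t).
  by move: (g t) (gn0 t) => z z0; field.
pose F t := c * ((2^-1 * ln (complex.Re (g t) ^+ 2 + complex.Im (g t) ^+ 2))
                 +i* atan (complex.Im (g t) / complex.Re (g t))).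
apply: (@circle_integral_exact R 2 f F).
- move=> t; have -> : (fun a => f (circle_pt 2 a)) = (fun a => c * (dg a / g a)).
    exact/funext.
  have dgd : exists d2, is_cderive t 1 dg d2.
    eexists; apply: is_cderiveN; apply: is_cderiveZ.
    apply: is_cderive_sum => j; apply: is_cderiveM.
      exact: (is_cderive_real (is_derive_circle_velocity j t)).
    apply: is_cderive_sum => r; apply: is_cderiveM; last exact: is_cderive_cst.
    exact: (is_cderive_real (is_derive_circle r t)).
  have [d2 dgd2] := dgd; eexists.
  exact: (is_cderiveZ c (is_cderiveM dgd2 (is_cderiveV (gn0 t) (gd t)))).
- by move=> t; rewrite E; apply: is_cderiveZ; exact: is_cderive_log.
- rewrite /F /g (_ : circle_pt 2 (2 * pi) = circle_pt 2 0) //.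
  by apply/rowP => i; rewrite !mxE mulr_natl cos2pi sin2pi cos0 sin0.
Qed.

Unset Implicit Arguments.

Theorem mainTheorem4 (R : realType) (n : nat) (hn : (2 <= n)%N)
    (A : 'M[R[i]]_n)
    (hA : exists kappa : R, 0 < kappa /\
      forall xi : 'rV[R]_n,
        kappa * (\sum_(i < n) xi 0 i ^+ 2) <=
        complex.Re (\sum_(r < n) \sum_(s < n)
                      A r s * (xi 0 r)%:C * (xi 0 s)%:C)) :
  distinguished A (2^-1 *: (A + A^T)) /\ distinguished A !=set0.
Proof.
suff dis : distinguished A (2^-1 *: (A + A^T)).
  by split=> //; exists (2^-1 *: (A + A^T)).
have [kappa [kappa0 ell]] := hA.
have symbE := symb_symmetrize A.
have symB r s : (2^-1 *: (A + A^T)) r s = (2^-1 *: (A + A^T)) s r.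
  by rewrite !mxE addrC.
have neg xi : xi != 0 -> complex.Re (symb (2^-1 *: (A + A^T)) xi) < 0.
  by rewrite -symbE; exact: symb_elliptic kappa0 (ell xi).
have invE : symb_inv A = symb_inv (2^-1 *: (A + A^T)).
  by rewrite /symb_inv symbE.
split; first exact: coef_tensors_symmetrize.
- move=> s s' xi xi0; rewrite invE.
  move: (2^-1 *: _) symB neg {symbE invE} => B symB neg.
  have nz : symb B xi != 0.
    by apply: contraTneq (neg xi xi0) => ->; rewrite ltxx.
  rewrite (symB s' s) subrr mul0r add0r sumrB -!mulr_suml.
  by rewrite !cpartial_symb_inv // -!/(conormal _ _ _); ring.
- move=> n2; rewrite invE.
  subst n; move=> s s'; exact: circle_condition.
Qed.
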